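(* Let $(W,S)$ be a simply-laced triangle-free Coxeter system. If ${\boldsymbol{\varphi}}$ is a Fibonacci link of rank $r$, then the braid graph $B({\boldsymbol{\varphi}})$ is isomorphic to the Fibonacci cube $\mathcal{F}_r$.
   Context: A Coxeter system $(W,S)$ consists of a finite set $S$ and a group $W$ with presentation $\langle S \mid (st)^{m(s,t)}=e\rangle$, $m(s,s)=1$, $m(s,t)\in\{2,3,\dots,\infty\}$ for $s\ne t$. Simply laced: $m(s,t)\le3$ for all $s,t$. Coxeter graph $\Gamma$: vertices $S$, edge $\{s,t\}$ iff $m(s,t)\ge3$; triangle free: $\Gamma$ has no three-cycles. Reduced expression: word in $S$ of minimal length representing a given element. Braid move: replace a consecutive subword $sts$ by $tst$ with $m(s,t)=3$. The braid class $[{\boldsymbol{\alpha}}]$ of a reduced expression ${\boldsymbol{\alpha}}$ is the set of reduced expressions reachable from ${\boldsymbol{\alpha}}$ by sequences of braid moves; the braid graph $B({\boldsymbol{\alpha}})$ has vertex set $[{\boldsymbol{\alpha}}]$ with edges between expressions differing by one braid move. For ${\boldsymbol{\alpha}}=s_{x_1}\cdots s_{x_m}$, the position interval $\llbracket i,i+2\rrbracket$ is a braid shadow of ${\boldsymbol{\alpha}}$ if $s_{x_i}=s_{x_{i+2}}$ and $m(s_{x_i},s_{x_{i+1}})=3$; $\operatorname{bs}({\boldsymbol{\alpha}})$ denotes the set of braid shadows, $\operatorname{bs}([{\boldsymbol{\alpha}}])=\bigcup_{{\boldsymbol{\beta}}\in[{\boldsymbol{\alpha}}]}\operatorname{bs}({\boldsymbol{\beta}})$,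 and $\operatorname{rank}({\boldsymbol{\alpha}})=|\operatorname{bs}([{\boldsymbol{\alpha}}])|$. A reduced expression ${\boldsymbol{\alpha}}$ with $m\ge1$ letters is a link if $m=1$, or $m$ is odd and $\operatorname{bs}([{\boldsymbol{\alpha}}])=\{\llbracket1,3\rrbracket,\llbracket3,5\rrbracket,\dots,\llbracket m-2,m\rrbracket\}$ (so a link of rank $r$ has $2r+1$ letters). A Fibonacci link is a link ${\boldsymbol{\varphi}}$ with $\operatorname{bs}([{\boldsymbol{\varphi}}])=\operatorname{bs}({\boldsymbol{\varphi}})$. The hypercube $Q_r$ has vertices $\{0,1\}^r$, adjacent iff differing in one digit. The Fibonacci cube $\mathcal{F}_r$ is the subgraph of $Q_r$ induced by the binary strings $a_1\cdots a_r$ with $a_ia_{i+1}=0$ for all $1\le i\le r-1$ (no two consecutive 1s). *)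

(* Defs.v *)
From HB Require Import structures.
From mathcomp Require Import all_boot.

Set Implicit Arguments.
Unset Strict Implicit.
Unset Printing Implicit Defensive.

(** * Simple graphs *)

Record graph := Graph {
  vertex :> finType;
  adj : rel vertex;
  adj_sym : symmetric adj;
  adj_irr : irreflexive adj }.

Definition graph_iso (G H : graph) : Prop :=
  exists2 f : G -> H, bijective f & forall x y : G, adj (f x) (f y) = adj x y.

Section Induced.
Variables (G : graph) (A : {set G}).

Definition induced_adj : rel {x : G | x \in A} :=
  [rel x y | adj (val x) (val y)].

Lemma induced_adj_sym : symmetric induced_adj.
Proof. by move=> x y; apply: adj_sym. Qed.

Lemma induced_adj_irr : irreflexive induced_adj.
Proof. by move=> x; apply: adj_irr. Qed.

Definition induced : graph := Graph induced_adj_sym induced_adj_irr.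
End Induced.

(** * Hypercubes and Fibonacci cubes *)

Definition cube_adj (r : nat) : rel (r.-tuple bool) :=
  [rel a b : r.-tuple bool | #|[set i : 'I_r | tnth a i != tnth b i]| == 1].

Lemma cube_adj_sym r : symmetric (@cube_adj r).
Proof.
by move=> a b; congr (_ == _); apply: eq_card => i; rewrite !inE eq_sym.
Qed.

Lemma cube_adj_irr r : irreflexive (@cube_adj r).
Proof.
by move=> a; rewrite /cube_adj /= eq_card0 // => i; rewrite !inE eqxx.
Qed.

Definition hypercube (r : nat) : graph :=
  Graph (@cube_adj_sym r) (@cube_adj_irr r).

Definition fibonacci_strings (r : nat) : {set hypercube r} :=
  [set a : r.-tuple bool | [forall i : 'I_r, forall j : 'I_r,
     (j == i.+1 :> nat) ==> ~~ (tnth a i && tnth a j)]].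

Definition fibonacci_cube (r : nat) : graph := induced (fibonacci_strings r).

(** * Group presentations *)

Section Presentation.
Variables (S : Type) (W : groupType) (gen : S -> W).

(* A letter (s, true) stands for s, and (s, false) for its formal inverse. *)
Definition signed_word := seq (S * bool).

Definition signed_val (u : signed_word) : W :=
  (\prod_(x <- u) (if x.2 then gen x.1 else (gen x.1)^-1))%g.

(* Equality in the quotient of the free group on S by the normal closure of
   the relators R. *)
Inductive pres_eq (R : signed_word -> Prop) :
    signed_word -> signed_word -> Prop :=
| PresRefl u : pres_eq R u u
| PresSym u v : pres_eq R u v -> pres_eq R v u
| PresTrans u v w : pres_eq R u v -> pres_eq R v w -> pres_eq R u w
| PresCancel u v s b :
    pres_eq R (u ++ [:: (s, b); (s, ~~ b)] ++ v) (u ++ v)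
| PresRel u v r : R r -> pres_eq R (u ++ r ++ v) (u ++ v).

Definition has_presentation (R : signed_word -> Prop) : Prop :=
  (forall x : W, exists u, signed_val u = x) /\
  (forall u v, signed_val u = signed_val v <-> pres_eq R u v).
End Presentation.

(** * Coxeter systems *)

(* None stands for an infinite entry. *)
Record coxeter_matrix (S : finType) := CoxeterMatrix {
  cox_m :> S -> S -> option nat;
  cox_diag : forall s, cox_m s s = Some 1;
  cox_sym : forall s t, cox_m s t = cox_m t s;
  cox_offdiag : forall s t k, s != t -> cox_m s t = Some k -> 2 <= k }.

Definition coxeter_relator (S : finType) (m : coxeter_matrix S)
    (r : signed_word S) : Prop :=
  exists s t k, m s t = Some k /\
    r = flatten (nseq k [:: (s, true); (t, true)]).

Record coxeter_system := CoxeterSystem {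
  cox_S : finType;
  cox_W : groupType;
  cox_mx : coxeter_matrix cox_S;
  cox_gen : cox_S -> cox_W;
  cox_pres : has_presentation cox_gen (coxeter_relator cox_mx) }.

Definition simply_laced (C : coxeter_system) : Prop :=
  forall s t : cox_S C, exists2 k, cox_mx C s t = Some k & k <= 3.

Definition cox_edge (C : coxeter_system) : rel (cox_S C) :=
  [rel s t | if cox_mx C s t is Some k then 3 <= k else true].

Definition triangle_free (C : coxeter_system) : Prop :=
  forall s t u : cox_S C,
    ~ [/\ cox_edge s t, cox_edge t u & cox_edge u s].

(** * Reduced expressions and braid graphs *)

Section Braids.
Variable C : coxeter_system.
Local Notation S := (cox_S C).
Local Notation m := (cox_mx C).

Definition word_val (w : seq S) : cox_W C := (\prod_(s <- w) cox_gen s)%g.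

Definition reduced (w : seq S) : bool :=
  [forall k : 'I_(size w), forall v : k.-tuple S, word_val v != word_val w].

Lemma reducedP (w : seq S) :
  reflect (forall v : seq S, word_val v = word_val w -> size w <= size v)
          (reduced w).
Proof.
apply: (iffP forallP) => [red v vw | min k].
  rewrite leqNgt; apply/negP => lt_vw.
  by have /forallP/(_ (in_tuple v)) := red (Ordinal lt_vw); rewrite vw eqxx.
apply/forallP => v; apply/negP => /eqP /min.
by rewrite size_tuple leqNgt ltn_ord.
Qed.

Variable n : nat.
Implicit Types u v w : n.-tuple S.

Definition braid_move : rel (n.-tuple S) :=
  [rel u v : n.-tuple S | [exists p : 'I_n, exists s : S, exists t : S,
    [&& m s t == Some 3,
        tval u == take p u ++ [:: s; t; s] ++ drop (p + 3) u &
        tval v == take p u ++ [:: t; s; t] ++ drop (p + 3) u]]].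

Lemma braid_moveP u v :
  reflect (exists a b s t, [/\ m s t = Some 3,
             tval u = a ++ [:: s; t; s] ++ b &
             tval v = a ++ [:: t; s; t] ++ b])
          (braid_move u v).
Proof.
apply: (iffP existsP) => [[p /existsP[s /existsP[t]]] |].
  case/and3P=> /eqP mst /eqP Eu /eqP Ev.
  by exists (take p u), (drop (p + 3) u), s, t.
case=> [a [b [s [t [mst Eu Ev]]]]].
have lt_a : size a < n.
  by rewrite -(size_tuple u) Eu !size_cat /= addnS ltnS leq_addr.
exists (Ordinal lt_a); apply/existsP; exists s; apply/existsP; exists t => /=.
have -> : take (size a) u = a by rewrite Eu take_size_cat.
have -> : drop (size a + 3) u = b.
  by rewrite Eu catA drop_size_cat // size_cat.
by rewrite mst Eu Ev !eqxx.
Qed.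

Lemma braid_move_sym : symmetric braid_move.
Proof.
have imp u v : braid_move u v -> braid_move v u.
  case/braid_moveP=> a [b [s [t [mst Eu Ev]]]]; apply/braid_moveP.
  by exists a, b, t, s; rewrite cox_sym.
by move=> u v; apply/idP/idP; apply: imp.
Qed.

Lemma braid_move_irr : irreflexive braid_move.
Proof.
move=> u; apply/negbTE/negP => /braid_moveP[a [b [s [t [mst -> /eqP]]]]].
rewrite eqseq_cat // eqxx /= !eqseq_cons => /andP[/eqP st _].
by move: mst; rewrite st cox_diag.
Qed.

Definition braid_move_graph : graph := Graph braid_move_sym braid_move_irr.

Definition braid_class w : {set braid_move_graph} :=
  [set v : n.-tuple S | reduced v && connect braid_move w v].

Definition braid_graph w : graph := induced (braid_class w).

(** * Braid shadows and links *)

(* A position interval is encoded by the pair of its endpoints; positions are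
   numbered from 0. *)
Definition braid_shadows w : {set 'I_n * 'I_n} :=
  [set ik : 'I_n * 'I_n | [exists j : 'I_n,
     [&& j == ik.1.+1 :> nat, ik.2 == ik.1.+2 :> nat,
         tnth w ik.1 == tnth w ik.2 &
         m (tnth w ik.1) (tnth w j) == Some 3]]].

Definition class_shadows w : {set 'I_n * 'I_n} :=
  \bigcup_(v in braid_class w) braid_shadows v.

Definition rank w : nat := #|class_shadows w|.

(* With positions numbered from 0, the intervals [1,3], [3,5], ..., [n-2,n]
   start at even positions. *)
Definition link_shadows : {set 'I_n * 'I_n} :=
  [set ik : 'I_n * 'I_n | ~~ odd ik.1 && (ik.2 == ik.1.+2 :> nat)].

Definition link w : Prop :=
  reduced w /\ (n = 1 \/ odd n /\ class_shadows w = link_shadows).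

Definition fibonacci_link w : Prop :=
  link w /\ class_shadows w = braid_shadows w.
End Braids.

(* Main.v *)
Require Import Defs.
From mathcomp Require Import all_boot.
From mathcomp Require Import zify.

Set Implicit Arguments.
Unset Strict Implicit.
Unset Printing Implicit Defensive.

(** A Fibonacci link reads [s t_0 s t_1 s ... t_(r-1) s] with every [t_i]
    adjacent to [s], so that, by triangle-freeness, no two of the [t_i] are
    adjacent. Applying the braid moves [s t_i s -> t_i s t_i] for [i] in a set
    without consecutive elements gives a word of the class.  From such a word
    the only available moves add or remove one element of the set: once
    [t_i s t_i] has been created, the letters [t_(i-1)] and [t_(i+1)] sit next
    to a [t_i], with which they commute, and moves starting at an odd position
    (counted from 0) are excluded by the definition of a link. *)

(** * Braid moves and shadows, letter by letter *)

Section BraidMoves.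
Variables (C : coxeter_system) (n : nat).
Local Notation S := (cox_S C).
Local Notation m := (cox_mx C).
Implicit Types u v w : n.-tuple S.

(** Multiply both sides on the right by [tst]: the left becomes [(st)^3 = 1], and the right becomes
    [1] because the generators are involutions. Then cancel. *)
Lemma cox_gen_braid (s t : S) : m s t = Some 3 ->
  (cox_gen s * (cox_gen t * cox_gen s) =
   cox_gen t * (cox_gen s * cox_gen t))%g.
Proof.
move=> mst.
have rel1 x : coxeter_relator m x -> signed_val (@cox_gen C) x = 1%g.
  move=> Rx; have [_ /(_ x [::]) [_ ->]] := cox_pres C.
    by rewrite /signed_val big_nil.
  by have := @PresRel _ _ [::] [::] x Rx; rewrite cats0.
have sq x : (cox_gen x * cox_gen x = 1 :> cox_W C)%g.
  have /rel1 : coxeter_relator m [:: (x, true); (x, true)].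
    by exists x, x, 1; rewrite cox_diag.
  by rewrite /signed_val !big_cons big_nil /= mulg1.
have /rel1 : coxeter_relator m (flatten (nseq 3 [:: (s, true); (t, true)])).
  by exists s, t, 3.
rewrite /signed_val /= !big_cons big_nil /= mulg1 => st3.
have: (cox_gen s * (cox_gen t * cox_gen s) *
       (cox_gen t * (cox_gen s * cox_gen t)) =
       cox_gen t * (cox_gen s * cox_gen t) *
       (cox_gen t * (cox_gen s * cox_gen t)))%g.
  rewrite -!mulgA st3 [(cox_gen t * (cox_gen t * _))%g]mulgA sq mul1g.
  by rewrite [(cox_gen s * (cox_gen s * _))%g]mulgA sq mul1g sq.
by move/mulIg.
Qed.

(** A braid move changes neither the length nor the group element. *)
Lemma reduced_braid_move u v : braid_move u v -> reduced u -> reduced v.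
Proof.
case/braid_moveP=> a [b [s [t [mst Eu Ev]]]] /reducedP red_u.
apply/reducedP => w Ew; have -> : size v = size u by rewrite !size_tuple.
apply: red_u; rewrite Ew Eu Ev /word_val !big_cat /= !big_cons !big_nil !mulg1.
by rewrite (cox_gen_braid mst).
Qed.

Lemma mem_braid_class_move w u v :
  u \in braid_class w -> braid_move u v -> v \in braid_class w.
Proof.
rewrite !inE => /andP[red_u con_u] uv; rewrite (reduced_braid_move uv) //=.
exact: connect_trans con_u (connect1 uv).
Qed.

(** This positional form suits words given by a formula for each letter, such as [moved_word],
    better than a factorization into subwords. *)
Lemma braid_move_nthP (x0 : S) u v :
  reflect (exists p, [/\ p.+2 < n, m (nth x0 u p) (nth x0 u p.+1) = Some 3,
             nth x0 u p.+2 = nth x0 u p &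
             forall q, q < n -> nth x0 v q =
               if q == p.+1 then nth x0 u p
               else if (q == p) || (q == p.+2) then nth x0 u p.+1
               else nth x0 u q])
          (braid_move u v).
Proof.
apply: (iffP (braid_moveP u v)) => [[a [b [s [t [mst Eu Ev]]]]] | ].
  have := size_tuple u; rewrite Eu !size_cat /= => sz.
  have nthE y z k : nth x0 (a ++ [:: y; z; y] ++ b) (size a + k) =
      nth x0 ([:: y; z; y] ++ b) k by rewrite nth_cat ltnNge leq_addr addKn.
  have := (nthE s t 0, nthE s t 1, nthE s t 2).
  rewrite addn0 addn1 addn2 [nth _ (_ ++ b) _]/= => -[[E0 E1] E2].
  exists (size a); rewrite Ev E0 E1 E2; split=> //; first lia.
  move=> q _; have [ltq|leq] := ltnP q (size a).
    by rewrite !nth_cat ltq !ifF //; lia.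
  have -> : q = size a + (q - size a) by lia.
  rewrite !nthE; case: (q - size a) => [|[|[|k]]] /=.
  - by rewrite ifF; [rewrite ifT //; lia | lia].
  - by rewrite ifT //; lia.
  - by rewrite ifF; [rewrite ifT //; lia | lia].
  - by rewrite ifF; [rewrite ifF //; lia | lia].
case=> p [lt_p mp up Ev].
exists (take p u), (drop (p + 3) u), (nth x0 u p), (nth x0 u p.+1).
have szt : size (take p u) = p by rewrite size_take size_tuple; case: ltnP; lia.
have szd : size (drop (p + 3) u) = n - (p + 3) by rewrite size_drop size_tuple.
split=> //.
  rewrite -{1}(cat_take_drop p u) (drop_nth x0) ?size_tuple; last lia.
  rewrite (drop_nth x0) ?size_tuple; last lia.
  by rewrite (drop_nth x0) ?size_tuple // up addn3.
apply: (@eq_from_nth _ x0) => [|q].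
  by rewrite !size_cat szt szd size_tuple /=; lia.
rewrite size_tuple => ltq; rewrite Ev // nth_cat szt.
have [ltqp|leqp] := ltnP q p.
  by rewrite nth_take // !ifF //; lia.
have [k ->] : exists k, q = p + k by exists (q - p); lia.
rewrite addKn; case: k => [|[|[|k]]] /=.
- by rewrite ifF; [rewrite ifT //; lia | lia].
- by rewrite ifT //; lia.
- by rewrite ifF; [rewrite ifT //; lia | lia].
- rewrite ifF; last lia; rewrite ifF; last lia.
  by rewrite nth_drop; congr nth; lia.
Qed.

Lemma mem_braid_shadows (x0 : S) u p :
  p.+2 < n -> nth x0 u p.+2 = nth x0 u p ->
  m (nth x0 u p) (nth x0 u p.+1) = Some 3 ->
  exists2 ik, ik \in braid_shadows u & ik.1 = p :> nat.
Proof.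
move=> lt2 up mp; have lt1 : p.+1 < n by lia.
have lt0 : p < n by lia.
exists (Ordinal lt0, Ordinal lt2) => //; rewrite inE.
apply/existsP; exists (Ordinal lt1) => /=.
by rewrite !(tnth_nth x0) /= !eqxx up eqxx mp eqxx.
Qed.

End BraidMoves.

(** The intervals are indexed by [i < r], the [i]-th one starting at [2 i]. This ties the length of
    a link to its rank. *)
Lemma card_link_shadows r : #|link_shadows r.*2.+1| = r.
Proof.
have lt1 (i : 'I_r) : i.*2 < r.*2.+1 by have := ltn_ord i; lia.
have lt2 (i : 'I_r) : i.*2.+2 < r.*2.+1 by have := ltn_ord i; lia.
pose f i := (Ordinal (lt1 i), Ordinal (lt2 i)).
have injf : injective f by move=> i j [] eij _; apply: val_inj => /=; lia.
rewrite -[RHS]card_ord -cardsT -(card_imset _ injf).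
apply: eq_card => -[i k]; rewrite inE /=; apply/andP/imsetP => [[oi /eqP Ek]|].
  have ltk := ltn_ord k; have lti : i./2 < r by lia.
  exists (Ordinal lti) => //; congr (_, _); apply: val_inj => /=; lia.
by case=> j _ [-> ->] /=; split; lia.
Qed.

(** * Words indexed by binary strings *)

Section FibonacciWords.
Variables (C : coxeter_system) (r : nat).
Local Notation S := (cox_S C).
Local Notation m := (cox_mx C).
Local Notation n := r.*2.+1.
Variables (phi : n.-tuple S) (s : S).
Implicit Types (i : 'I_r) (a b : r.-tuple bool).

Definition alternating_center := [/\ triangle_free C,
  forall p, p < n -> ~~ odd p -> nth s phi p = s &
  forall p, p < n -> odd p -> m s (nth s phi p) = Some 3].

(* The word obtained from [phi] by the moves [s t_i s -> t_i s t_i] for all [i]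
   with [A i]; [t_i] stands at position [2 i + 1], and position [2 i] is shared
   by the moves [i - 1] and [i]. *)
Definition moved_letter (A : nat -> bool) (p : nat) : S :=
  if odd p then (if A p./2 then s else nth s phi p)
  else if A p./2 then nth s phi p.+1
  else if (0 < p) && A p./2.-1 then nth s phi p.-1 else s.

Definition moved_word (a : r.-tuple bool) : n.-tuple S :=
  [tuple moved_letter (nth false a) p | p < n].

Definition flip (i : 'I_r) (a : r.-tuple bool) : r.-tuple bool :=
  [tuple tnth a j (+) (j == i) | j < r].

Lemma nth_flip i a k : nth false (flip i a) k = nth false a k (+) (k == i).
Proof.
have [ltk|lek] := ltnP k r.
  by rewrite -(tnth_nth _ _ (Ordinal ltk)) tnth_mktuple (tnth_nth false).
by rewrite !nth_default ?size_tuple //; have := ltn_ord i; lia.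
Qed.

Lemma nth_moved_word a p :
  p < n -> nth s (moved_word a) p = moved_letter (nth false a) p.
Proof.
by move=> ltp; rewrite -(tnth_nth _ _ (Ordinal ltp)) tnth_mktuple.
Qed.

(** The default [false] past the end of the string makes unbounded indices harmless. *)
Lemma fibonacci_stringsP (a : r.-tuple bool) :
  reflect (forall k, nth false a k -> nth false a k.+1 -> False)
          (a \in fibonacci_strings r).
Proof.
rewrite inE; apply: (iffP forallP) => [fib k ak ak1 | fib i].
  have lt1 : k.+1 < r.
    by rewrite ltnNge; apply/negP => le; rewrite nth_default ?size_tuple in ak1.
  have /forallP/(_ (Ordinal lt1)) := fib (Ordinal (ltnW lt1)).
  by rewrite /= eqxx !(tnth_nth false) /= ak ak1.
apply/forallP => j; apply/implyP => /eqP Ej; apply/negP => /andP[].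
by rewrite !(tnth_nth false) Ej => ai /(fib _ ai).
Qed.

Lemma cube_adjP (a b : r.-tuple bool) :
  reflect (exists i, b = flip i a) (cube_adj a b).
Proof.
apply: (iffP cards1P) => -[i] => [/setP Ei | ->].
  exists i; apply: eq_from_tnth => j; have := Ei j.
  by rewrite !inE tnth_mktuple => <-; case: (tnth a j); case: (tnth b j).
exists i; apply/setP => j; rewrite !inE tnth_mktuple.
by case: (j == i); case: (tnth a j).
Qed.

Hypothesis phiP : alternating_center.

(** An edge between two such letters would close a triangle with [s]. *)
Lemma odd_letters_commute p q : p < n -> q < n -> odd p -> odd q ->
  m (nth s phi p) (nth s phi q) <> Some 3.
Proof.
case: phiP => tf _ s_odd ltp ltq op oq mpq.
apply: (tf s (nth s phi p) (nth s phi q)).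
by rewrite /cox_edge /= mpq s_odd // cox_sym s_odd.
Qed.

(** Each [t_i] differs from [s], since [m s s] is 1 and not 3. Hence the odd positions of a word
    decode its string. *)
Lemma moved_letter_eq_center a p :
  p < n -> odd p -> (moved_letter (nth false a) p == s) = nth false a p./2.
Proof.
case: phiP => _ _ s_odd ltp op; rewrite /moved_letter op.
case: (nth false a _); first exact: eqxx.
by apply/eqP => Es; have := s_odd _ ltp op; rewrite Es cox_diag.
Qed.

Lemma moved_word_inj : injective moved_word.
Proof.
move=> a b Eab; apply: eq_from_tnth => i; rewrite !(tnth_nth false).
have lti : i.*2.+1 < n by have := ltn_ord i; lia.
have E (c : r.-tuple bool) :
    nth false c i = (nth s (moved_word c) i.*2.+1 == s).
  by rewrite nth_moved_word // moved_letter_eq_center //;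
     [congr nth|]; rewrite /=; lia.
by rewrite !E Eab.
Qed.

Lemma moved_word0 : moved_word (nseq_tuple r false) = phi.
Proof.
case: phiP => _ s_even _.
apply/val_inj/(@eq_from_nth _ s) => [|p]; first by rewrite !size_tuple.
rewrite size_tuple => ltp; rewrite nth_moved_word // /moved_letter !nth_nseq.
by rewrite !if_same andbF; case: ifP => // /negbT op; rewrite s_even.
Qed.

(** The condition for toggling bit [i] inside the Fibonacci strings. Bit [i] itself is left free, so
    that toggling it preserves the condition; the guard [0 < i] is there because [0.-1] is [0]. *)
Definition isolated (i : 'I_r) (a : r.-tuple bool) : bool :=
  ~~ ((0 < i) && nth false a i.-1) && ~~ nth false a i.+1.

Lemma isolated_flip i a : isolated i (flip i a) = isolated i a.
Proof.
rewrite /isolated !nth_flip [i.+1 == _]gtn_eqF // addbF.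
by case: (nat_of_ord i) => [|k] //=; rewrite [k == _]ltn_eqF // addbF.
Qed.

Lemma fibonacci_isolated i a :
  a \in fibonacci_strings r -> nth false a i -> isolated i a.
Proof.
move/fibonacci_stringsP => fib ai; apply/andP; split; apply/negP.
  by case/andP=> i0 /fib; apply; rewrite prednK.
exact: fib.
Qed.

(** Bit [i] is set in exactly one of [a] and [flip i a], and isolation can be read off from that
    one. *)
Lemma fibonacci_flip i a : a \in fibonacci_strings r ->
  (flip i a \in fibonacci_strings r) = isolated i a.
Proof.
move=> fib; apply/idP/idP => [fibf | /andP[iso0 iso1]].
  have [ai|nai] := boolP (nth false a i); first exact: fibonacci_isolated.
  rewrite -isolated_flip; apply: fibonacci_isolated => //.
  by rewrite nth_flip (negbTE nai) eqxx.
apply/fibonacci_stringsP => k; rewrite !nth_flip.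
have [->|nki] := eqVneq k i; first by rewrite gtn_eqF // addbF (negbTE iso1).
rewrite addbF; have [Ek|_] := eqVneq k.+1 i.
  by move: iso0; rewrite -Ek /= => /negbTE ->.
by rewrite addbF; apply/fibonacci_stringsP.
Qed.

(** With both neighbouring bits clear, the shared positions [2 i] and [2 i + 2] depend on bit [i]
    alone, so the window reads [tst] or [sts]. *)
Lemma moved_letters_isolated i a : isolated i a ->
  let L := moved_letter (nth false a) in
  let t := nth s phi i.*2.+1 in
  [/\ L i.*2 = if nth false a i then t else s,
      L i.*2.+1 = if nth false a i then s else t &
      L i.*2.+2 = if nth false a i then t else s].
Proof.
case/andP=> iso0 iso1; rewrite /moved_letter /= odd_double /= uphalf_double.
rewrite doubleK (negbTE iso1) /=; split=> //.
by case: ifP => // _; rewrite double_gt0 (negbTE iso0).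
Qed.

Lemma moved_letter_flip_out i a q :
  q != i.*2 -> q != i.*2.+1 -> q != i.*2.+2 ->
  moved_letter (nth false (flip i a)) q = moved_letter (nth false a) q.
Proof.
move=> q0 q1 q2; rewrite /moved_letter !nth_flip.
have -> : (q./2 == i) = false by lia.
rewrite !addbF; have [q_gt0|] := boolP (0 < q); last by [].
case: (boolP (odd q)) => // oq.
have -> : (q./2.-1 == i) = false by lia.
by rewrite addbF.
Qed.

Lemma moved_word_flip_nth i a q : isolated i a -> q < n ->
  nth s (moved_word (flip i a)) q =
    if q == i.*2.+1 then nth s (moved_word a) i.*2
    else if (q == i.*2) || (q == i.*2.+2) then nth s (moved_word a) i.*2.+1
    else nth s (moved_word a) q.
Proof.
move=> iso ltq; have lti := ltn_ord i.
have isof : isolated i (flip i a) by rewrite isolated_flip.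
have [L0 L1 L2] := moved_letters_isolated iso.
have [F0 F1 F2] := moved_letters_isolated isof.
have fi : nth false (flip i a) i = ~~ nth false a i.
  by rewrite nth_flip eqxx addbT.
rewrite !nth_moved_word //; try lia.
have [->|q1] := eqVneq q i.*2.+1; first by rewrite F1 L0 fi; case: (nth false a i).
have [->|q0] := eqVneq q i.*2; first by rewrite F0 L1 fi; case: (nth false a i).
have [->|q2] := eqVneq q i.*2.+2; first by rewrite F2 L1 fi; case: (nth false a i).
exact: moved_letter_flip_out.
Qed.

Lemma braid_move_flip i a :
  isolated i a -> braid_move (moved_word a) (moved_word (flip i a)).
Proof.
move=> iso; have lti := ltn_ord i; have [_ _ s_odd] := phiP.
apply/(braid_move_nthP s); exists i.*2.
have [L0 L1 L2] := moved_letters_isolated iso.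
rewrite !nth_moved_word; try lia.
rewrite L0 L1 L2; split=> //; first lia; last first.
  move=> q ltq; rewrite moved_word_flip_nth // !nth_moved_word ?L0 ?L1 //; lia.
have mst : m s (nth s phi i.*2.+1) = Some 3 by apply: s_odd; lia.
by case: (nth false a i) => //; rewrite cox_sym.
Qed.

(** If bit [i] is clear, the middle letter is [t_i]. A set neighbouring bit would put [t_(i-1)] or
    [t_(i+1)] at an end of the window, and the shadow would then require an edge between two odd
    letters of [phi]. *)
Lemma isolated_of_shadow i a : a \in fibonacci_strings r ->
  m (nth s (moved_word a) i.*2) (nth s (moved_word a) i.*2.+1) = Some 3 ->
  nth s (moved_word a) i.*2.+2 = nth s (moved_word a) i.*2 ->
  isolated i a.
Proof.
move=> fib; have lti := ltn_ord i.
have [ai _ _|nai] := boolP (nth false a i); first exact: fibonacci_isolated.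
rewrite !nth_moved_word; try lia.
have oddE : moved_letter (nth false a) i.*2.+1 = nth s phi i.*2.+1.
  by rewrite /moved_letter /= odd_double /= uphalf_double (negbTE nai).
rewrite oddE => mp Ep; apply/andP; split; apply/negP.
  case/andP=> i_gt0 ai1; move: mp.
  rewrite /moved_letter odd_double doubleK (negbTE nai) double_gt0 i_gt0 ai1 /=.
  by apply: odd_letters_commute; lia.
(* The two ends of a shadow agree, so the edge at its left end is also an edge at its right end,
   where [t_(i+1)] stands. *)
move=> ai1; move: mp; rewrite -Ep /moved_letter /= odd_double /= doubleK ai1.
apply: odd_letters_commute; try lia.
rewrite ltnS; have: i.+1 < r; last lia.
by rewrite ltnNge; apply/negP => le; rewrite nth_default ?size_tuple in ai1.
Qed.

(** * The braid class and its graph *)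

Hypothesis phi_reduced : reduced phi.
Hypothesis class_phi : class_shadows phi = link_shadows n.

Lemma class_shadow_even u p : u \in braid_class phi ->
  p.+2 < n -> nth s u p.+2 = nth s u p ->
  m (nth s u p) (nth s u p.+1) = Some 3 -> ~~ odd p.
Proof.
move=> uphi ltp up mp; have [ik ik_u <-] := mem_braid_shadows ltp up mp.
have: ik \in class_shadows phi by apply/bigcupP; exists u.
by rewrite class_phi inE => /andP[].
Qed.

Lemma braid_move_moved_word a v : a \in fibonacci_strings r ->
  moved_word a \in braid_class phi -> braid_move (moved_word a) v ->
  exists i, flip i a \in fibonacci_strings r /\ v = moved_word (flip i a).
Proof.
move=> fib aphi /(braid_move_nthP s)[p [ltp mp up Ev]].
have ep := class_shadow_even aphi ltp up mp.
have lti : p./2 < r by lia.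
have Ep : p = (Ordinal lti).*2 by rewrite /=; lia.
move: ltp mp up Ev; rewrite Ep; set i := Ordinal lti => ltp mp up Ev.
have iso := isolated_of_shadow fib mp up.
exists i; split; first by rewrite fibonacci_flip.
apply/val_inj/(@eq_from_nth _ s) => [|q]; first by rewrite !size_tuple.
by rewrite size_tuple => ltq; rewrite Ev // moved_word_flip_nth.
Qed.

Lemma braid_class_moved_word v : v \in braid_class phi ->
  exists2 a, a \in fibonacci_strings r & v = moved_word a.
Proof.
rewrite inE => /andP[_ /connectP[w pw ->]] {v}.
have fib0 : nseq_tuple r false \in fibonacci_strings r.
  by apply/fibonacci_stringsP => k; rewrite nth_nseq if_same.
have: phi \in braid_class phi by rewrite inE phi_reduced connect0.
(* Writing [phi] as the word of the zero string lets the start of the path vary in the induction. *)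
rewrite -{1 3}moved_word0; move: pw; rewrite -{1}moved_word0.
elim: w (nseq_tuple r false) fib0 => [|v w IHw] a fib /=; first by exists a.
case/andP=> av pw aphi; have vphi := mem_braid_class_move aphi av.
have [i [fibi Ev]] := braid_move_moved_word fib aphi av.
by rewrite Ev in pw vphi *; apply: IHw.
Qed.

(** Induction on the number of ones: clearing one of them keeps the string Fibonacci, and a single
    braid move leads back. *)
Lemma moved_word_braid_class a :
  a \in fibonacci_strings r -> moved_word a \in braid_class phi.
Proof.
have [k] := ubnP (count id a); elim: k a => // k IHk a lta fib.
have [/hasP[x xa tx]|na] := boolP (has id a); last first.
  suff -> : a = nseq_tuple r false.
    by rewrite moved_word0 inE phi_reduced connect0.
  apply: val_inj => /=; apply: (@eq_from_nth _ false).
    by rewrite size_tuple size_nseq.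
  move=> j ltj; rewrite nth_nseq if_same; apply/negP => aj.
  by case/hasP: na; exists (nth false a j); rewrite ?mem_nth.
have [j aj] : exists j : 'I_r, tnth a j.
  by have /tnthP[j Ej] := xa; exists j; rewrite -Ej.
have iso : isolated j a by apply: fibonacci_isolated; rewrite -?tnth_nth.
have fibj : flip j a \in fibonacci_strings r by rewrite fibonacci_flip.
apply: mem_braid_class_move (IHk _ _ fibj) _; last first.
  by rewrite braid_move_sym braid_move_flip.
rewrite -ltnS; apply: leq_trans lta; rewrite ltnS.
have cE (b : r.-tuple bool) : count id b = \sum_(i < r) tnth b i.
  rewrite -sum1_count big_mkcond big_tuple.
  by apply: eq_bigr => i _; case: (tnth b i).
rewrite !cE (bigD1 j) //= [ltnRHS](bigD1 j) //= tnth_mktuple aj eqxx add0n.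
rewrite add1n ltnS leq_sum // => i /negbTE ij.
by rewrite tnth_mktuple ij addbF.
Qed.

Lemma braid_move_moved_wordE a b :
  a \in fibonacci_strings r -> b \in fibonacci_strings r ->
  braid_move (moved_word a) (moved_word b) = cube_adj a b.
Proof.
move=> fiba fibb; apply/idP/cube_adjP => [ab | [i Eb]].
  have [i [_ Eb]] :=
    braid_move_moved_word fiba (moved_word_braid_class fiba) ab.
  by exists i; apply: moved_word_inj.
by rewrite Eb braid_move_flip // -fibonacci_flip // -Eb.
Qed.

Lemma braid_graph_fibonacci_cube :
  graph_iso (braid_graph phi) (fibonacci_cube r).
Proof.
pose g (a : fibonacci_cube r) : braid_graph phi :=
  exist _ (moved_word (val a)) (moved_word_braid_class (valP a)).
have bij_g : bijective g.
  have inj_g : injective g.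
    by move=> a b /(congr1 val) /= /moved_word_inj /val_inj.
  have sur_g v : v \in codom g.
    apply/codomP; have [a fib Ev] := braid_class_moved_word (valP v).
    by exists (exist _ a fib); apply: val_inj.
  have inv v := sig_eqW (codomP (sur_g v)).
  exists (fun v => sval (inv v)) => [a | v].
    by apply: inj_g; case: (inv (g a)).
  by case: (inv v).
(* The isomorphism must start from the braid graph, so it is the inverse of [g]. *)
have [f gf fg] := bij_g; exists f; first by exists g.
move=> x y; rewrite -{2}(fg x) -{2}(fg y).
by symmetry; apply: braid_move_moved_wordE; apply: valP.
Qed.

End FibonacciWords.

(** * Reduction of a Fibonacci link to an alternating word *)

Theorem theorem6p10 (C : coxeter_system) (n r : nat)
    (phi : n.-tuple (cox_S C)) :
  simply_laced C -> triangle_free C ->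
  fibonacci_link phi -> rank phi = r ->
  graph_iso (braid_graph phi) (fibonacci_cube r).
Proof.
move=> _ tf [[red lk] sh] rk.
have [oddn Ecl] : odd n /\ class_shadows phi = link_shadows n.
  (* For a single letter both sets are empty: no interval of three positions fits. *)
  case: lk => // n1; subst n; split=> //; apply/setP => -[i k].
  rewrite sh !inE (ord1 i) (ord1 k); apply/existsP => -[j].
  by case/and4P.
have [k En] : exists k, n = k.*2.+1 by exists n./2; lia.
subst n; rewrite /rank Ecl card_link_shadows in rk; subst k.
pose s := tnth phi ord0.
have shE (i : nat) : i < r ->
    nth s phi i.*2.+2 = nth s phi i.*2 /\
    cox_mx C (nth s phi i.*2) (nth s phi i.*2.+1) = Some 3.
  move=> ltir; have lt1 : i.*2 < r.*2.+1 by lia.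
  have lt2 : i.*2.+2 < r.*2.+1 by lia.
  (* The Fibonacci condition places every shadow of the class in [phi] itself. *)
  have: (Ordinal lt1, Ordinal lt2) \in braid_shadows phi.
    by rewrite -sh Ecl inE /= odd_double eqxx.
  rewrite inE => /existsP[j] /and4P[/eqP Ej _ /eqP E1 /eqP E2].
  by move: E1 E2; rewrite !(tnth_nth s) Ej /=.
(* Consecutive shadows share an endpoint, so equality with the first letter propagates through the
   even positions. *)
have even_s i : i <= r -> nth s phi i.*2 = s.
  elim: i => [|i IHi] lei; first by rewrite /s [in RHS](tnth_nth s).
  by rewrite doubleS; have [-> _] := shE i lei; apply: IHi; lia.
apply: (@braid_graph_fibonacci_cube _ _ phi s) => //; split=> //.
  move=> p ltp ep; have -> : p = p./2.*2 by lia.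
  by apply: even_s; lia.
move=> p ltp op; have Ep : p = p./2.*2.+1 by lia.
have lep : p./2 < r by lia.
by have [_] := shE _ lep; rewrite -Ep even_s //; lia.
Qed.
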